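(* Let $p$ be an odd prime, let $1\le i<n$, and set $$C_i:=\mathbb{F}_p[Q_{n,0},Q_{n,1},\dots,\widehat{Q_{n,i}},\dots,Q_{n,n-1}].$$ Then $$D_n=C_i[Q_{n,i}]=\bigoplus_{r=0}^{p-1}C_i[Q_{n,i}^p]\,Q_{n,i}^r$$ as a $C_i[Q_{n,i}^p]$-module, and the normalized derivation $\delta_i\colon D_n\to D_n$ satisfies $$\ker(\delta_i)=C_i[Q_{n,i}^p],\qquad \mathrm{Im}(\delta_i)=\bigoplus_{r=0}^{p-2}C_i[Q_{n,i}^p]\,Q_{n,i}^r.$$ Consequently, for $\mathrm{St}^{\Delta_i}\colon D_n\to D_n$, $$\ker(\mathrm{St}^{\Delta_i})=C_i[Q_{n,i}^p],\qquad \mathrm{Im}(\mathrm{St}^{\Delta_i})=Q_{n,0}\bigoplus_{r=0}^{p-2}C_i[Q_{n,i}^p]\,Q_{n,i}^r.$$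
   Context: Let $p$ be an odd prime, $n\ge 1$, and $P_n=\mathbb{F}_p[x_1,\dots,x_n]$. For integers $e_1,\dots,e_n\ge 0$ put $[e_1,\dots,e_n]:=\det\big(x_r^{p^{e_s}}\big)_{1\le r,s\le n}\in P_n$. Let $L_n=[0,1,\dots,n-1]$ and $L_{n,s}=[0,1,\dots,\widehat{s},\dots,n]$ for $0\le s<n$ (a hat means omission). The Dickson invariants are $Q_{n,s}=L_{n,s}/L_n$ $(0\le s<n)$; in particular $Q_{n,0}=L_n^{p-1}$. The Dickson algebra is $D_n=P_n^{\mathrm{GL}_n(\mathbb{F}_p)}=\mathbb{F}_p[Q_{n,0},\dots,Q_{n,n-1}]$, a polynomial algebra on these generators. For $i\ge1$, $\mathrm{St}^{\Delta_i}$ denotes the Steenrod--Milnor operation dual to the monomial $\xi_i$ in Milnor's dual mod-$p$ Steenrod algebra. It acts on $P_n$ as the unique $\mathbb{F}_p$-linear derivation with $\mathrm{St}^{\Delta_i}(x_r)=x_r^{p^i}$ $(1\le r\le n)$, and it maps $D_n$ into $D_n$. On a localization of $D_n$, $\mathrm{St}^{\Delta_i}$ means the unique derivation extending $\mathrm{St}^{\Delta_i}|_{D_n}$. The normalized derivation is $\delta_i:=(-1)^nQ_{n,0}^{-1}\mathrm{St}^{\Delta_i}$ on $D_n[Q_{n,0}^{-1}]$; it maps $D_n$ into $D_n$, and here it is regarded as an operator on $D_n$. *)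

(* Defs.v *)
From HB Require Import structures.
From mathcomp Require Import all_boot all_order all_algebra.
From mathcomp Require Import ring.
From mathcomp Require Import classical_sets mpoly.

Set Implicit Arguments.
Unset Strict Implicit.
Unset Printing Implicit Defensive.

Import GRing.Theory.
Local Open Scope ring_scope.
Local Open Scope classical_set_scope.

(* All objects live in Frac(P_n): subrings of P_n and of its localizations
   are represented as subsets of Frac(P_n). *)
Definition fracP (p n : nat) := {fraction {mpoly 'F_p[n]}}.

Notation toK := (@FracField.tofrac _).

Definition subring (K : nzRingType) (A : set K) : Prop :=
  [/\ A 1, forall x y, A x -> A y -> A (x - y)
         & forall x y, A x -> A y -> A (x * y)].

(* A[S], for A a subring *)
Definition adjoin (K : nzRingType) (A S : set K) : set K :=
  smallest (@subring K) (A `|` S).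

Definition sum_sets (V : zmodType) (m : nat) (N : 'I_m -> set V) : set V :=
  [set x | exists2 v : 'I_m -> V, forall r, N r (v r) & x = \sum_r v r].

Definition independent (V : zmodType) (m : nat) (N : 'I_m -> set V) : Prop :=
  forall v : 'I_m -> V, (forall r, N r (v r)) -> \sum_r v r = 0 ->
  forall r, v r = 0.

Definition is_direct_sum (V : zmodType) (M : set V) (m : nat)
    (N : 'I_m -> set V) : Prop :=
  M = sum_sets N /\ independent N.

(* The summand B y^r. *)
Definition power_summand (K : nzRingType) (B : set K) (y : K) (r : nat) : set K :=
  [set b * y ^+ r | b in B].

Definition bracket (p n : nat) (e : 'I_n -> nat) : {mpoly 'F_p[n]} :=
  \det (\matrix_(r < n, s < n) ('X_r : {mpoly 'F_p[n]}) ^+ (p ^ e s)).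

Definition dicksonL (p n : nat) : {mpoly 'F_p[n]} :=
  bracket p (fun j : 'I_n => nat_of_ord j).

(* For s <= n, [j |-> bump s j] enumerates 0, .., n with s omitted. *)
Definition dicksonLs (p n s : nat) : {mpoly 'F_p[n]} :=
  bracket p (fun j : 'I_n => bump s j).

Definition dicksonQ (p n s : nat) : fracP p n :=
  toK (dicksonLs p n s) / toK (dicksonL p n).

Definition lin_subst (p n : nat) (g : 'M['F_p]_n) (f : {mpoly 'F_p[n]}) :
    {mpoly 'F_p[n]} :=
  f \mPo [tuple \sum_(s < n) g r s *: 'X_s | r < n].

Definition dicksonD (p n : nat) : set (fracP p n) :=
  [set toK f | f in
    [set f : {mpoly 'F_p[n]} |
      forall g : 'M['F_p]_n, g \in unitmx -> lin_subst g f = f]].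

Arguments dicksonD : clear implicits.

Definition constants (p n : nat) : set (fracP p n) :=
  range (fun c : 'F_p => toK (c%:MP : {mpoly 'F_p[n]})).

Arguments constants : clear implicits.

Definition dicksonC (p n i : nat) : set (fracP p n) :=
  adjoin (constants p n)
    [set dicksonQ p n s | s in [set s : nat | (s < n)%N /\ s <> i]].

Arguments dicksonC : clear implicits.

Definition St_poly (p n i : nat) (f : {mpoly 'F_p[n]}) : {mpoly 'F_p[n]} :=
  \sum_(r < n) 'X_r ^+ (p ^ i) * f^`M(r).

Arguments St_poly p {n} i f.

(* Quotient rule; independent of the representative when [s] is a
   derivation, see [quot_ruleE]. *)
Definition quot_rule (R : idomainType) (s : R -> R) (x : {fraction R}) :
    {fraction R} :=
  let: (a, b) := frac (repr x) in toK (s a * b - a * s b) / toK b ^+ 2.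

(* The derivation of Frac(P_n) extending [St_poly]; on each localization of
   D_n it restricts to the derivation extending the one on D_n.
   See [St_toK], [St_derivation] and [St_unique]. *)
Definition St (p n i : nat) (x : fracP p n) : fracP p n :=
  quot_rule (St_poly p i) x.

Arguments St p {n} i x.

Definition delta (p n i : nat) (x : fracP p n) : fracP p n :=
  (-1) ^+ n * (dicksonQ p n 0%N)^-1 * St p i x.

Arguments delta p {n} i x.

Definition derivation (K : nzRingType) (d : K -> K) : Prop :=
  (forall x y, d (x + y) = d x + d y) /\
  (forall x y, d (x * y) = d x * y + x * d y).

Lemma St_polyD p n i (f g : {mpoly 'F_p[n]}) :
  St_poly p i (f + g) = St_poly p i f + St_poly p i g.
Proof.
rewrite /St_poly -big_split /=; apply: eq_bigr => r _.
by rewrite mderivD mulrDr.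
Qed.

Lemma St_polyM p n i (f g : {mpoly 'F_p[n]}) :
  St_poly p i (f * g) = St_poly p i f * g + f * St_poly p i g.
Proof.
rewrite /St_poly mulr_suml mulr_sumr -big_split /=; apply: eq_bigr => r _.
by rewrite mderivM; ring.
Qed.

Lemma St_polyX p n i (r : 'I_n) :
  St_poly p i ('X_r : {mpoly 'F_p[n]}) = 'X_r ^+ (p ^ i).
Proof.
rewrite /St_poly (bigD1 r) //= mderivX mnm1E eqxx scale1r.
have -> : (U_(r) - U_(r) = 0 :> 'X_{1..n})%MM.
  by apply/mnmP => j; rewrite mnmBE subnn mnm0E.
rewrite mpolyX0 mulr1 big1 ?addr0 // => s ne_sr.
by rewrite mderivX mnm1E eq_sym (negbTE ne_sr) scale0r mulr0.
Qed.

Lemma frac_repr (R : idomainType) (x : {fraction R}) :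
  x = toK (frac (repr x)).1 / toK (frac (repr x)).2.
Proof.
have d0 : toK (frac (repr x)).2 != 0 by rewrite tofrac_eq0 denom_ratioP.
apply: (canRL (mulfK d0)).
rewrite -{1}[x]reprK; set u := repr x.
unlock FracField.tofrac.
rewrite -[LHS]FracField.pi_mul; apply/eqmodP => /=.
rewrite FracField.equivfE /FracField.mulf.
rewrite !numden_Ratio ?mulf_neq0 ?oner_neq0 ?denom_ratioP //.
by rewrite !mulr1 mulrC.
Qed.

Lemma frac_eqP (R : idomainType) (a b c d : R) : b != 0 -> d != 0 ->
  (toK a / toK b = toK c / toK d) <-> a * d = c * b.
Proof.
move=> b0 d0.
have tb0 : toK b != 0 by rewrite tofrac_eq0.
have td0 : toK d != 0 by rewrite tofrac_eq0.
split=> [/eqP|e]; last apply/eqP.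
  by rewrite eqr_div // -!tofracM tofrac_eq => /eqP.
by rewrite eqr_div // -!tofracM tofrac_eq; apply/eqP.
Qed.

Lemma quot_ruleE (R : idomainType) (s : R -> R) (a b : R) :
  derivation s -> b != 0 ->
  quot_rule s (toK a / toK b) = toK (s a * b - a * s b) / toK b ^+ 2.
Proof.
move=> [_ sM] b0; rewrite /quot_rule.
have := frac_repr (toK a / toK b).
have := denom_ratioP (repr (toK a / toK b)).
move: (frac (repr _)) => -[c d] /= d0 /(frac_eqP _ _ b0 d0) adcb.
rewrite -!tofracXn; apply/frac_eqP; rewrite ?expf_neq0 //.
have := congr1 s adcb; rewrite !sM => H.
have -> : (s c * d - c * s d) * b ^+ 2 =
  (s c * b + c * s b) * (b * d) - (c * b) * (b * s d + s b * d) by ring.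
by rewrite -H -adcb; ring.
Qed.

Lemma quot_rule_tofrac (R : idomainType) (s : R -> R) (a : R) :
  derivation s -> quot_rule s (toK a) = toK (s a).
Proof.
move=> ds; have s1 : s 1 = 0.
  by apply: (addrI (s 1)); rewrite addr0 -{3}[1]mulr1 ds.2 mulr1 mul1r.
have -> : toK a = toK a / toK 1 by rewrite tofrac1 divr1.
by rewrite quot_ruleE ?oner_neq0 // s1 mulr1 mulr0 subr0 tofrac1 expr1n divr1.
Qed.

Lemma quot_rule_derivation (R : idomainType) (s : R -> R) :
  derivation s -> derivation (quot_rule s).
Proof.
move=> ds; have [sD sM] := ds.
split=> x y; rewrite (frac_repr x) (frac_repr y).
all: move: (frac (repr x)) (denom_ratioP (repr x)) => -[a b] /= b0.
all: move: (frac (repr y)) (denom_ratioP (repr y)) => -[c d] /= d0.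
all: have tb0 : toK b != 0 by rewrite tofrac_eq0.
all: have td0 : toK d != 0 by rewrite tofrac_eq0.
  rewrite addf_div // -!tofracM -tofracD !quot_ruleE ?mulf_neq0 //.
  rewrite addf_div ?expf_neq0 // -!tofracXn -!tofracM -tofracD.
  by rewrite -exprMn sD !sM; congr (toK _ / _); ring.
rewrite mulf_div -!tofracM !quot_ruleE ?mulf_neq0 //.
have mf u v w z : toK u / toK v * (toK w / toK z) = toK (u * w) / toK (v * z)
  :> {fraction R} by rewrite mulf_div -!tofracM.
have af u v w z : v != 0 -> z != 0 -> toK u / toK v + toK w / toK z =
    toK (u * z + w * v) / toK (v * z) :> {fraction R}.
  by move=> v0 z0; rewrite addf_div ?tofrac_eq0 // -!tofracM -tofracD.
rewrite -!tofracXn !mf af ?mulf_neq0 ?expf_neq0 //.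
apply/frac_eqP; rewrite ?mulf_neq0 ?expf_neq0 ?mulf_neq0 //.
by rewrite !sM; ring.
Qed.

Lemma quot_rule_unique (R : idomainType) (s : R -> R)
    (d : {fraction R} -> {fraction R}) :
  derivation s -> derivation d -> (forall a, d (toK a) = toK (s a)) ->
  forall x, d x = quot_rule s x.
Proof.
move=> ds dd ds_eq x; have [_ dM] := dd.
have [_ sM] := quot_rule_derivation ds.
rewrite (frac_repr x).
move: (frac (repr x)) (denom_ratioP (repr x)) => -[a b] /= b0.
have tb0 : toK b != 0 by rewrite tofrac_eq0.
apply: (mulIf tb0).
have h1 := dM (toK a / toK b) (toK b).
have h2 := sM (toK a / toK b) (toK b).
rewrite divfK // in h1 h2.
apply: (addIr (toK a / toK b * d (toK b))); rewrite -h1.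
by rewrite (ds_eq a) (ds_eq b) -(quot_rule_tofrac b ds) -h2 quot_rule_tofrac.
Qed.

Lemma St_poly_derivation p n i : derivation (@St_poly p n i).
Proof. by split; [exact: St_polyD | exact: St_polyM]. Qed.

Lemma St_poly_unique p n i (d : {mpoly 'F_p[n]} -> {mpoly 'F_p[n]}) :
  derivation d -> (forall r : 'I_n, d 'X_r = 'X_r ^+ (p ^ i)) ->
  forall f, d f = St_poly p i f.
Proof.
move=> [dD dM] dX f.
have [sD sM] := @St_poly_derivation p n i.
have base (D : {mpoly 'F_p[n]} -> {mpoly 'F_p[n]}) : derivation D ->
    [/\ D 0 = 0, D 1 = 0 & forall c : 'F_p, D c%:MP = 0].
  move=> [DD DM].
  have D0 : D 0 = 0 by apply: (addrI (D 0)); rewrite -DD !addr0.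
  have D1 : D 1 = 0.
    by apply: (addrI (D 1)); rewrite addr0 -{3}[1]mulr1 DM mulr1 mul1r.
  split=> // c; rewrite -[c]natr_Zp rmorph_nat.
  by elim: (nat_of_ord c) => // m IH; rewrite -natr1 DD IH D1 addr0.
have [d0 d1 dC] := base d (conj dD dM).
have [s0 s1 sC] := base _ (@St_poly_derivation p n i).
rewrite [f]mpolyE.
elim: (msupp f) => [|m t IH]; first by rewrite !big_nil d0 s0.
rewrite !big_cons dD sD IH; congr (_ + _).
rewrite -mul_mpolyC dM sM dC sC; congr (_ + _ * _).
rewrite mpolyXE_id.
elim: (index_enum _) => [|r u IHu]; first by rewrite !big_nil d1 s1.
rewrite !big_cons dM sM IHu; congr (_ * _ + _).
elim: (m r) => [|k IHk]; first by rewrite expr0 d1 s1.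
by rewrite exprS dM sM IHk dX St_polyX.
Qed.

Lemma St_toK p n i (f : {mpoly 'F_p[n]}) :
  St p i (toK f : fracP p n) = toK (St_poly p i f).
Proof. exact: quot_rule_tofrac (@St_poly_derivation p n i). Qed.

Lemma St_derivation p n i : derivation (@St p n i).
Proof. exact: quot_rule_derivation (@St_poly_derivation p n i). Qed.

Lemma St_unique p n i (d : fracP p n -> fracP p n) : derivation d ->
  (forall f, d (toK f) = toK (St_poly p i f)) -> forall x, d x = St p i x.
Proof. exact: quot_rule_unique (@St_poly_derivation p n i). Qed.

(* Main.v *)
From HB Require Import structures.
Require Import Defs.
From mathcomp Require Import all_boot all_order all_algebra.
From mathcomp Require Import perm zify ring classical_sets mpoly.

(* Up to sign, the Q_s are the coefficients of F = prod_v (X - v), v ranging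
   over the F_p-span V of the variables: the polynomial
   sum_s (-1)^(n+s) Q_s X^(p^s), a Laplace expansion divided by L_n, is monic
   of degree p^n and vanishes on V.  Applying St to F(x_r) = 0, where only the
   term of degree 1 is differentiated, and using that the powers x_r^(p^s),
   s < n, are independent, gives St(Q_s) = 0 for s <> i and
   St(Q_i) = (-1)^(i+1) Q_0.  So delta is +-d/dQ_i on C[Q_i], and its kernel,
   its image and the directness of the sums all follow by differentiation.

   That D_n is generated by the Q_s is shown by descending induction on k: the
   invariants of the pointwise stabilizer of x_0, .., x_(k-1) are
   S_k = F_p[Q_0, .., Q_(n-1)][x_0, .., x_(k-1)].  An invariant f lies in
   S_(k+1), so f = g(x_k) with g over S_k; reduce g modulo the monic polynomial
   h_k = prod_v (X - v), v in V outside the span of x_0, .., x_(k-1).  The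
   stabilizer permutes the roots of h_k transitively, so g - f vanishes at all
   of them; having smaller degree, g = f is a constant of S_k[X]. *)

Set Implicit Arguments.
Unset Strict Implicit.
Unset Printing Implicit Defensive.

Import GRing.Theory.
Local Open Scope ring_scope.
Local Open Scope classical_set_scope.

(** * Polynomials over a subring *)

Section Subrings.

Variables (R : idomainType) (A : set R).
Hypothesis A_subring : subring A.

Let AB : forall x y, A x -> A y -> A (x - y). Proof. by case: A_subring. Qed.

Lemma subring1 : A 1. Proof. by case: A_subring. Qed.

Lemma subringM x y : A x -> A y -> A (x * y).
Proof. by case: A_subring => _ _; apply. Qed.

Lemma subring0 : A 0.
Proof. by rewrite -(subrr 1); apply: AB; exact: subring1. Qed.

Lemma subringN x : A x -> A (- x).
Proof. by rewrite -sub0r; apply: AB; exact: subring0. Qed.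

Lemma subringD x y : A x -> A y -> A (x + y).
Proof. by move=> Ax Ay; rewrite -[y]opprK; apply/AB/subringN. Qed.

Lemma subringX x k : A x -> A (x ^+ k).
Proof.
move=> Ax; elim: k => [|k IHk]; first exact: subring1.
by rewrite exprS; exact: subringM.
Qed.

Lemma subring_natr k : A k%:R.
Proof.
elim: k => [|k IHk]; first exact: subring0.
by rewrite -natr1; apply: subringD => //; exact: subring1.
Qed.

Lemma subring_sum (I : Type) (r : seq I) (P : pred I) (F : I -> R) :
  (forall k, P k -> A (F k)) -> A (\sum_(k <- r | P k) F k).
Proof.
by move=> AF; apply: big_ind => //; [exact: subring0 | exact: subringD].
Qed.

Lemma subring_prod (I : Type) (r : seq I) (P : pred I) (F : I -> R) :
  (forall k, P k -> A (F k)) -> A (\prod_(k <- r | P k) F k).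
Proof.
by move=> AF; apply: big_ind => //; [exact: subring1 | exact: subringM].
Qed.

End Subrings.

(** Subrings are sets here, so A[X] is likewise a set of polynomials over [R]. *)
Definition coefs_in (R : idomainType) (A : set R) : set {poly R} :=
  [set g | forall j, A g`_j].

Lemma subring_coefs_in (R : idomainType) (A : set R) :
  subring A -> subring (coefs_in A).
Proof.
move=> sA; split=> [j|f g Af Ag j|f g Af Ag j].
- by rewrite coef1; exact: subring_natr.
- by rewrite coefB; apply: subringD => //; apply: subringN.
- by rewrite coefM; apply: subring_sum => // k _; apply: subringM.
Qed.

Lemma coefs_inC (R : idomainType) (A : set R) c :
  subring A -> A c -> coefs_in A c%:P.
Proof.
by move=> sA Ac j; rewrite coefC; case: ifP => // _; exact: subring0.
Qed.

Lemma coefs_inX (R : idomainType) (A : set R) : subring A -> coefs_in A 'X.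
Proof. by move=> sA j; rewrite coefX; exact: subring_natr. Qed.

Lemma coefs_in_XsubC (R : idomainType) (A : set R) c :
  subring A -> A c -> coefs_in A ('X - c%:P).
Proof.
move=> sA Ac; have [_ sB _] := subring_coefs_in sA.
by apply: sB; [exact: coefs_inX | exact: coefs_inC].
Qed.

Lemma coefs_in_deriv (R : idomainType) (A : set R) (g : {poly R}) :
  subring A -> coefs_in A g -> coefs_in A g^`().
Proof.
move=> sA Ag j; rewrite coef_deriv -mulr_natr.
by apply: subringM => //; exact: subring_natr.
Qed.

Lemma subring_horner (R : idomainType) (A : set R) (g : {poly R}) x :
  subring A -> coefs_in A g -> A x -> A g.[x].
Proof.
move=> sA Ag Ax; rewrite horner_coef; apply: subring_sum => // k _.
by apply: subringM => //; exact: subringX.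
Qed.

Lemma subring_adjoin (R : idomainType) (A S : set R) : subring (adjoin A S).
Proof.
split=> [B [[]]//|x y Ax Ay B HB|x y Ax Ay B HB];
by have := (Ax _ HB, Ay _ HB); case: HB => -[_ BB BM] _ [Bx By]; auto.
Qed.

Lemma sub_adjoin (R : idomainType) (A S : set R) : A `<=` adjoin A S.
Proof. by move=> x Ax; apply: sub_gen_smallest; left. Qed.

Lemma adjoin_gen (R : idomainType) (A S : set R) : S `<=` adjoin A S.
Proof. by move=> x Ax; apply: sub_gen_smallest; right. Qed.

Lemma adjoin_min (R : idomainType) (A S B : set R) :
  subring B -> A `<=` B -> S `<=` B -> adjoin A S `<=` B.
Proof. by move=> sB AB SB; apply: smallest_sub => // x [/AB|/SB]. Qed.

(** The values at [y] of polynomials over [A] form a subring containing [A] and [y], and lie in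
    every such subring. *)
Lemma adjoin1E (R : idomainType) (A : set R) y :
  subring A -> adjoin A [set y] = [set g.[y] | g in coefs_in A].
Proof.
move=> sA; have sAX := subring_coefs_in sA.
apply/seteqP; split=> [|_ [g Ag <-]]; last first.
  apply: (subring_horner (subring_adjoin _ _)) => [j|]; last exact: adjoin_gen.
  by apply: sub_adjoin; exact: Ag.
apply: adjoin_min => [|x Ax|_ ->].
- split=> [|_ _ [f Af <-] [g Ag <-]|_ _ [f Af <-] [g Ag <-]].
  + by exists 1; [exact: (subring1 sAX) | rewrite hornerC].
  + by exists (f - g); [case: sAX; auto | rewrite !hornerE].
  + by exists (f * g); [exact: (subringM sAX) | rewrite hornerM].
- by exists x%:P; [exact: coefs_inC | rewrite hornerC].
- by exists 'X; [exact: coefs_inX | rewrite hornerX].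
Qed.

(** Long division by a monic polynomial never divides coefficients, so quotient and remainder stay
    over [A]. *)
Lemma monic_division (R : idomainType) (A : set R) (h f : {poly R}) :
  subring A -> coefs_in A h -> h \is monic -> coefs_in A f ->
  exists q r, [/\ coefs_in A q, coefs_in A r, f = q * h + r
                & (size r < size h)%N].
Proof.
move=> sA Ah mh; have sAX := subring_coefs_in sA.
have [m] := ubnP (size f); elim: m f => // m IHm f /ltnSE le_fm Af.
have [lt_fh|le_hf] := ltnP (size f) (size h).
  by exists 0, f; rewrite mul0r add0r; split=> //; exact: (subring0 sAX).
have h_gt0 : (0 < size h)%N by rewrite size_poly_gt0 monic_neq0.
pose t : {poly R} := (lead_coef f)%:P * 'X^(size f - size h).
have At : coefs_in A t.
  apply: (subringM sAX); first exact: (coefs_inC sA (Af _)).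
  by apply: (subringX sAX); exact: coefs_inX.
have lt_m : (size (f - t * h)%R < m)%N.
  apply: leq_trans le_fm; have f_gt0 := leq_trans h_gt0 le_hf.
  rewrite -(prednK f_gt0) ltnS; apply/leq_sizeP => j le_j.
  rewrite coefB /t -mulrA coefCM coefXnM.
  have [->|ne_j] := eqVneq j (size f).-1.
    case: ltnP => [|_]; first by rewrite ltnNge; move: h_gt0 le_hf; lia.
    have -> : ((size f).-1 - (size f - size h))%N = (size h).-1.
      by move: h_gt0 le_hf; lia.
    by rewrite -lead_coefE -[h`_ _]lead_coefE (monicP mh) mulr1 subrr.
  have lt_j : (size f <= j)%N by move: f_gt0 le_j ne_j; lia.
  rewrite (leq_sizeP _ _ (leqnn (size f))) // sub0r.
  case: ltnP => [|_]; first by rewrite mulr0 oppr0.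
  by rewrite nth_default ?mulr0 ?oppr0 // -{1}(subKn le_hf) leq_sub2r.
have [|q [r [Aq Ar e lt_r]]] := IHm _ lt_m.
  by apply: (subringD sAX) => //; apply: (subringN sAX); exact: (subringM sAX).
exists (q + t), r; split=> //; first exact: (subringD sAX).
by rewrite mulrDl addrAC -e subrK.
Qed.

(** * Derivations with a slice *)

Section DerivationWithSlice.

Variables (K : fieldType) (p : nat) (pK : p \in [pchar K]).
Variables (d : K -> K) (d_der : derivation d).

Let dD : forall x y, d (x + y) = d x + d y. Proof. by case: d_der. Qed.
Let dM : forall x y, d (x * y) = d x * y + x * d y. Proof. by case: d_der. Qed.

Lemma derivation0 : d 0 = 0.
Proof. by apply: (addrI (d 0)); rewrite -dD !addr0. Qed.

Lemma derivation1 : d 1 = 0.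
Proof. by apply: (addrI (d 1)); rewrite addr0 -{3}[1]mulr1 dM mulr1 mul1r. Qed.

Lemma derivationN x : d (- x) = - d x.
Proof. by apply: (addIr (d x)); rewrite -dD !addNr derivation0. Qed.

Lemma subring_ker_derivation : subring [set x | d x = 0].
Proof.
split=> [|x y /= dx dy|x y /= dx dy]; first exact: derivation1.
  by rewrite dD derivationN dx dy subr0.
by rewrite dM dx dy mul0r mulr0 addr0.
Qed.

Lemma derivationXn x k : d (x ^+ k) = x ^+ k.-1 *+ k * d x.
Proof.
elim: k => [|k IHk]; first by rewrite derivation1 mul0r.
rewrite exprS dM IHk mulrS mulrDl [d x * _]mulrC; congr (_ + _).
case: k {IHk} => [|k]; first by rewrite mulr0n !mul0r mulr0.
by rewrite mulrA mulrnAr -exprS.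
Qed.

Lemma derivation_horner (g : {poly K}) y :
  (forall j, d g`_j = 0) -> d g.[y] = g^`().[y] * d y.
Proof.
elim/poly_ind: g => [|g c IHg] dg.
  by rewrite deriv0 !horner0 derivation0 mul0r.
have dg' j : d g`_j = 0.
  by have := dg j.+1; rewrite -cons_poly_def coef_cons.
have dc : d c = 0 by have := dg 0%N; rewrite -cons_poly_def coef_cons.
rewrite !derivE !hornerE dD dc addr0 dM IHg // [RHS]mulrDl addrC; congr (_ + _).
by rewrite mulrAC.
Qed.

(** The derivative has coefficients j * g_j, and each j with 0 < j < [p] is nonzero in [K]. *)
Lemma deriv_eq0_const (g : {poly K}) :
  (size g <= p)%N -> g^`() = 0 -> g = (g`_0)%:P.
Proof.
move=> le_gp dg0; apply/polyP => -[|j]; rewrite coefC //=.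
have := congr1 (fun h : {poly K} => h`_j) dg0.
rewrite coef_deriv coef0 => /eqP.
have [lt_jp|le_pj] := ltnP j.+1 p; last first.
  by rewrite nth_default // (leq_trans le_gp).
rewrite -mulr_natr mulf_eq0 -(dvdn_pcharf pK) => /orP[/eqP->//|/dvdn_leq].
by move=> /(_ isT); rewrite leqNgt lt_jp.
Qed.

Variables (y : K) (dy0 : d y != 0).

(* Differentiating a relation of degree < p on y gives a shorter one. *)
Lemma slice_free (g : {poly K}) :
  (forall j, d g`_j = 0) -> (size g <= p)%N -> g.[y] = 0 -> g = 0.
Proof.
have [m] := ubnP (size g); elim: m g => // m IHm g /ltnSE le_gm dg le_gp gy0.
have [->//|g0] := eqVneq g 0.
have g'0 : g^`() = 0.
  apply: IHm.
  - by apply: leq_trans le_gm; rewrite lt_size_deriv.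
  - by move=> j; apply: (coefs_in_deriv subring_ker_derivation).
  - exact: leq_trans (ltnW (lt_size_deriv g0)) le_gp.
  - apply/eqP; rewrite -(inj_eq (mulIf dy0)) mul0r -derivation_horner //.
    by rewrite gy0 derivation0.
move: gy0; rewrite (deriv_eq0_const le_gp g'0) hornerC => ->.
by rewrite polyC0.
Qed.


Variables (C : set K) (C_subring : subring C).
Hypothesis dC : forall x, C x -> d x = 0.
(** [d y] will be a sign; as its own inverse, it can be divided by inside [C]. *)
Hypotheses (Cdy : C (d y)) (dy_sqr : d y * d y = 1).

Local Notation D := (adjoin C [set y]).
Local Notation B := (adjoin C [set y ^+ p]).
Local Notation N := (power_summand B y).

(** Trades families of summands for polynomials over [B], which can be divided and
    differentiated. *)
Lemma sum_power_summandE m :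
  sum_sets (fun r : 'I_m => N r) =
    [set g.[y] | g in [set g : {poly K} | coefs_in B g /\ (size g <= m)%N]].
Proof.
have sB : subring B by exact: subring_adjoin.
apply/seteqP; split=> [_ [v Nv ->]|_ [g [Bg le_gm] <-]]; last first.
  exists (fun r : 'I_m => g`_r * y ^+ r) => [r|]; first by exists g`_r.
  rewrite (horner_coef_wide _ le_gm) //.
apply: big_ind => [|_ _ [f [Bf le_fm] <-] [g [Bg le_gm] <-]|r _].
- exists 0; last by rewrite horner0.
  by split; [exact: (subring0 (subring_coefs_in sB)) | rewrite size_poly0].
- exists (f + g); last by rewrite hornerD.
  split; first exact: (subringD (subring_coefs_in sB)).
  by rewrite (leq_trans (size_polyD _ _)) // geq_max le_fm.
have [b Bb <-] := Nv r.
exists (b%:P * 'X^r); last by rewrite !hornerE.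
split.
  apply: (subringM (subring_coefs_in sB)); first exact: coefs_inC.
  by apply: (subringX (subring_coefs_in sB)); exact: coefs_inX.
by rewrite mul_polyC (leq_trans (size_scale_leq _ _)) // size_polyXn.
Qed.

Lemma slice_ker_subset x : B x -> d x = 0.
Proof.
apply: (adjoin_min subring_ker_derivation); first exact: dC.
by move=> _ ->; rewrite /= derivationXn -mulr_natr (pcharf0 pK) mulr0 mul0r.
Qed.

(** A vanishing sum is a relation of degree below [p] on [y] with coefficients killed by [d], hence
    trivial by [slice_free]. *)
Lemma power_summand_independent m :
  (m <= p)%N -> independent (fun r : 'I_m => N r).
Proof.
move=> le_mp v Nv v0.
have vE (r : 'I_m) : exists c, B c /\ c * y ^+ r = v r.
  by have [c] := Nv r; exists c.
have [b Bb] := fin_all_exists vE.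
(* [oapp] and [insub] extend [b] by 0 to all natural indices. *)
pose g : {poly K} := \poly_(r < m) oapp b 0 (insub r).
have gE (r : 'I_m) : g`_r = b r by rewrite coef_poly ltn_ord valK.
have g0 : g = 0.
  apply: slice_free.
  - move=> j; rewrite coef_poly.
    case: ltnP => [lt_jm|_]; last exact: derivation0.
    by rewrite insubT /=; apply: slice_ker_subset; case: (Bb (Sub j lt_jm)).
  - exact: leq_trans (size_poly _ _) le_mp.
  - rewrite (horner_coef_wide _ (size_poly _ _)) -[RHS]v0.
    by apply: eq_bigr => r _; rewrite gE; case: (Bb r).
by move=> r; have [_ <-] := Bb r; rewrite -gE g0 coef0 mul0r.
Qed.

(** [y] is a root of X^p - y^p, which is monic over [B]; reduction modulo it leaves degree below
    [p]. *)
Lemma slice_total : D = sum_sets (fun r : 'I_p => N r).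
Proof.
rewrite sum_power_summandE adjoin1E //.
have sB : subring B by exact: subring_adjoin.
apply/seteqP; split=> [_ [g Cg <-]|_ [g [Bg _] <-]]; last first.
  have sD := subring_adjoin C [set y]; have Dy : D y by exact: adjoin_gen.
  rewrite -adjoin1E //; apply: (subring_horner sD) => // j.
  apply: (adjoin_min sD) (Bg j); first exact: sub_adjoin.
  by move=> _ ->; exact: (subringX sD).
have p_gt0 : (0 < p)%N by rewrite prime_gt0 // (pcharf_prime pK).
have Bh : coefs_in B ('X^p - (y ^+ p)%:P).
  apply: (subringD (subring_coefs_in sB)).
    by apply: (subringX (subring_coefs_in sB)); exact: coefs_inX.
  apply: (subringN (subring_coefs_in sB)); apply: coefs_inC => //.
  exact: adjoin_gen.
have Bg : coefs_in B g by move=> j; apply: sub_adjoin; exact: Cg.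
have [q [r [_ Br -> lt_r]]] := monic_division sB Bh (monicXnsubC _ p_gt0) Bg.
exists r; last by rewrite !hornerE subrr mulr0 add0r.
by split=> //; rewrite -ltnS -(size_XnsubC (y ^+ p) p_gt0).
Qed.

(** An element is g(y) with deg g < [p]. If [d] kills it, then g'(y) = 0, so g' = 0 by freeness and
    g is a constant in [B]. *)
Lemma slice_ker : [set x | D x /\ d x = 0] = B.
Proof.
have sB : subring B by exact: subring_adjoin.
have p_gt0 : (0 < p)%N by rewrite prime_gt0 // (pcharf_prime pK).
rewrite slice_total sum_power_summandE.
apply/seteqP; split=> [_ [[g [Bg le_gp] <-]]|x Bx]; last first.
  split; last exact: slice_ker_subset.
  exists x%:P; last by rewrite hornerC.
  by split; [exact: coefs_inC | rewrite (leq_trans (size_polyC_leq1 _))].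
have dg j : d g`_j = 0 by exact: slice_ker_subset.
rewrite derivation_horner // => /eqP.
rewrite mulf_eq0 (negbTE dy0) orbF => /eqP g'0.
rewrite (@deriv_eq0_const g) ?hornerC //.
have [->|g0] := eqVneq g 0; first by rewrite deriv0.
apply: slice_free => //.
  by move=> j; apply: slice_ker_subset; exact: (coefs_in_deriv sB Bg).
exact: leq_trans (ltnW (lt_size_deriv g0)) le_gp.
Qed.

(** Differentiation takes degree below p to degree below p - 1. Conversely, antiderivatives of the
    latter need only the denominators 1, .., p - 1, invertible in F_p. *)
Lemma slice_image : [set d x | x in D] = sum_sets (fun r : 'I_p.-1 => N r).
Proof.
have sB : subring B by exact: subring_adjoin.
have Bdy : B (d y) by exact: sub_adjoin.
have p_prime := pcharf_prime pK.
have p_gt0 : (0 < p)%N by rewrite prime_gt0.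
rewrite slice_total !sum_power_summandE.
apply/seteqP; split=> [_ [_ [g [Bg le_gp] <-] <-]|_ [g [Bg le_gp] <-]].
  have dg j : d g`_j = 0 by exact: slice_ker_subset.
  exists ((d y)%:P * g^`()); last first.
    by rewrite derivation_horner // !hornerE mulrC.
  split.
    apply: (subringM (subring_coefs_in sB)); first exact: coefs_inC.
    exact: coefs_in_deriv.
  rewrite mul_polyC (leq_trans (size_scale_leq _ _)) // -ltnS prednK //.
  have [->|g0] := eqVneq g 0; first by rewrite deriv0 size_poly0.
  by rewrite (leq_trans (lt_size_deriv g0)).
(* Bezout gives the inverse of j + 1 as a natural number, and every subring contains those. *)
have inv_nat j : (j < p.-1)%N -> exists k : nat, (j.+1 * k)%:R = 1 :> K.
  move=> lt_jp; have jp : coprime j.+1 p.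
    rewrite coprime_sym prime_coprime //; apply/negP => /dvdn_leq.
    by move=> /(_ isT); rewrite leqNgt -(prednK p_gt0) ltnS lt_jp.
  have [k l e _] := egcdnP p (isT : 0 < j.+1)%N.
  exists k; rewrite mulnC e (eqnP jp) natrD natrM (pcharf0 pK) mulr0.
  by rewrite add0r.
(* An antiderivative of [d y] times [g]; this factor cancels the one from the chain rule. At j = 0
   the quotient by 0 is 0, so [f] has no constant term. *)
pose f : {poly K} := \poly_(j < p) (g`_j.-1 * d y / j%:R).
have Bf : coefs_in B f.
  move=> [|j]; rewrite coef_poly.
    by rewrite p_gt0 invr0 mulr0; exact: subring0.
  case: ltnP => lt_jp; last exact: subring0.
  have [k e] : exists k : nat, (j.+1 * k)%:R = 1 :> K by apply: inv_nat; lia.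
  have -> : (j.+1%:R)^-1 = k%:R :> K.
    by apply/esym/divr1_eq; rewrite invrK -natrM mulnC.
  by apply: (subringM sB); [exact: (subringM sB) | exact: subring_natr].
exists f.[y]; first by exists f => //; split=> //; exact: size_poly.
have df j : d f`_j = 0 by exact: slice_ker_subset.
rewrite derivation_horner //.
have -> : f^`() = (d y)%:P * g.
  apply/polyP => j; rewrite coef_deriv coefCM coef_poly.
  have [lt_jp|le_pj] := ltnP j.+1 p; last first.
    by rewrite mul0rn nth_default ?mulr0 // (leq_trans le_gp) //; lia.
  rewrite /= -[(_ / _) *+ _]mulr_natr divfK 1?mulrC //.
  have [|k] := inv_nat j; first by lia.
  by rewrite natrM; apply: contra_eq_neq => ->; rewrite mul0r eq_sym oner_eq0.
by rewrite !hornerE mulrAC dy_sqr mul1r.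
Qed.

End DerivationWithSlice.

(** * Generators of the invariants *)

Section LinearSubstitutions.

Variables p n : nat.
Local Notation P := {mpoly 'F_p[n]}.

Implicit Types (g : 'M['F_p]_n) (c : 'rV['F_p]_n) (f : P).

HB.instance Definition _ g := GRing.RMorphism.copy (lin_subst g)
  (comp_mpoly [tuple \sum_(s < n) g r s *: 'X_s | r < n]).

(** Elements of V are handled through their coordinate rows, a finite type over which products can
    range. *)
Definition lin_form c : P := \sum_s c 0 s *: 'X_s.

Lemma lin_substC g (a : 'F_p) : lin_subst g a%:MP = a%:MP.
Proof. exact: comp_mpolyC. Qed.

Lemma lin_substX g (r : 'I_n) : lin_subst g 'X_r = lin_form (row r g).
Proof.
rewrite /lin_subst comp_mpolyXU -tnth_nth tnth_mktuple /lin_form.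
by apply: eq_bigr => s _; rewrite mxE.
Qed.

Lemma lin_subst_form g c : lin_subst g (lin_form c) = lin_form (c *m g).
Proof.
rewrite /lin_form rmorph_sum /=.
under eq_bigr => r _ do
  rewrite -mul_mpolyC rmorphM /= lin_substC lin_substX mulr_sumr.
rewrite exchange_big /=; apply: eq_bigr => s _.
rewrite mxE scaler_suml; apply: eq_bigr => r _.
by rewrite mxE mul_mpolyC scalerA.
Qed.

Lemma lin_form_inj : injective lin_form.
Proof.
have lin_formE c r : (lin_form c)@_U_(r) = c 0 r.
  rewrite /lin_form raddf_sum /= (bigD1 r) //= mcoeffZ mcoeffX eqxx mulr1.
  rewrite big1 ?addr0 // => s ne_sr; rewrite mcoeffZ mcoeffX.
  by rewrite eq_mnm1 (negbTE ne_sr) mulr0.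
by move=> c c' e; apply/rowP => r; rewrite -!lin_formE e.
Qed.

Lemma lin_form_delta (r : 'I_n) : lin_form (delta_mx 0 r) = 'X_r.
Proof.
rewrite /lin_form (bigD1 r) //= mxE !eqxx scale1r big1 ?addr0 // => s ne_sr.
by rewrite mxE (negbTE ne_sr) andbF scale0r.
Qed.

(** Put [c] in row [j] of the identity, which stays invertible as c_j is nonzero, then swap rows [k]
    and [j]; earlier rows are untouched. This yields transitivity of the stabilizer on the roots of
    h_k. *)
Lemma exists_unitmx_row (k j : 'I_n) c : (k <= j)%N -> c 0 j != 0 ->
  exists2 g, g \in unitmx &
    row k g = c /\ forall r : 'I_n, (r < k)%N -> row r g = delta_mx 0 r.
Proof.
move=> le_kj cj0.
pose E : 'M['F_p]_n := \matrix_(r, s) if r == j then c 0 s else (r == s)%:R.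
have E_unit : E \in unitmx.
  rewrite -row_free_unit -kermx_eq0; apply/rowV0P => v /sub_kermxP vE0.
  (* Coordinate s of v E = 0. At s = j it reads v_j c_j = 0, and then the others give v_s = 0. *)
  have vE s : v 0 j * c 0 s + (if s == j then 0 else v 0 s) = 0.
    have := congr1 (fun w : 'rV__ => w 0 s) vE0.
    rewrite !mxE (bigD1 j) //= mxE eqxx.
    move=> {2}<-; congr (_ + _).
    have [->|ne_sj] := eqVneq s j.
      by rewrite big1 // => r ne_rj; rewrite mxE (negbTE ne_rj) mulr0.
    rewrite (bigD1 s) //= mxE (negbTE ne_sj) eqxx mulr1 big1 ?addr0 // => r.
    by case/andP=> ne_rj ne_rs; rewrite mxE (negbTE ne_rj) (negbTE ne_rs) mulr0.
  have vj0 : v 0 j = 0.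
    by have /eqP := vE j; rewrite eqxx addr0 mulf_eq0 (negbTE cj0) orbF => /eqP.
  apply/rowP => s; rewrite mxE; have := vE s; rewrite vj0 mul0r add0r.
  by case: eqP => [->|].
exists (xrow k j E); first by rewrite xrowE unitmx_mul unitmx_perm.
split=> [|r lt_rk]; apply/rowP => s; rewrite !mxE.
  by rewrite tpermL eqxx.
have ne_rk : r != k by apply: contraTneq lt_rk => ->; rewrite ltnn.
have ne_rj : r != j.
  by apply: contraTneq lt_rk => ->; rewrite -leqNgt.
by rewrite tpermD 1?[_ == r]eq_sym // (negbTE ne_rj) eqxx eq_sym.
Qed.

End LinearSubstitutions.

Definition orbit_poly (p n : nat) : {poly {mpoly 'F_p[n]}} :=
  \prod_(c : 'rV_n) ('X - (lin_form c)%:P).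

(** * Invariants of the pointwise stabilizers of the first variables *)

Section InvariantsGenerated.

Variables (p n : nat).
Local Notation P := {mpoly 'F_p[n]}.

Definition fixes_first (k : nat) (g : 'M['F_p]_n) : Prop :=
  g \in unitmx /\ forall r : 'I_n, (r < k)%N -> lin_subst g 'X_r = 'X_r.

Lemma subring_fixed g : subring [set f : P | lin_subst g f = f].
Proof.
split=> [|x y /= gx gy|x y /= gx gy]; first exact: rmorph1.
  by rewrite rmorphB /= gx gy.
by rewrite rmorphM /= gx gy.
Qed.

(** [A] plays F_p[Q_0, .., Q_(n-1)]: a ring of invariants containing the constants and the
    coefficients of F. *)
Variable A : set P.
Hypotheses (A_subring : subring A) (AC : forall a : 'F_p, A a%:MP).
Hypothesis A_orbit : coefs_in A (orbit_poly p n).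
Hypothesis A_fixed : forall f g, A f -> g \in unitmx -> lin_subst g f = f.

(** The ring S_k. *)
Definition adjoin_first (k : nat) : set P :=
  adjoin A [set 'X_r | r in [set r : 'I_n | (r < k)%N]].

Lemma adjoin_first_fixed k f g :
  adjoin_first k f -> fixes_first k g -> lin_subst g f = f.
Proof.
move=> Sf [g_unit gX]; apply: (adjoin_min (subring_fixed g)) Sf.
  by move=> a Aa; exact: A_fixed.
by move=> _ [r lt_rk <-]; exact: gX.
Qed.

Lemma adjoin_firstS (k : 'I_n) :
  adjoin_first k.+1 `<=` adjoin (adjoin_first k) [set 'X_k].
Proof.
apply: adjoin_min; first exact: subring_adjoin.
  by move=> a Aa; apply: sub_adjoin; exact: sub_adjoin.
move=> _ [r /= + <-]; rewrite ltnS leq_eqVlt => /orP[/eqP/val_inj ->|lt_rk].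
  exact: adjoin_gen.
by apply: sub_adjoin; apply: adjoin_gen; exists r.
Qed.

(** The start k = n of the descending induction: all variables have been adjoined. *)
Lemma adjoin_first_total f : adjoin_first n f.
Proof.
have sS : subring (adjoin_first n) by exact: subring_adjoin.
rewrite [f]mpolyE; apply: (subring_sum sS) => m _; rewrite -mul_mpolyC.
apply: (subringM sS); first exact: sub_adjoin.
rewrite mpolyXE_id; apply: (subring_prod sS) => r _.
by apply: (subringX sS); apply: adjoin_gen; exists r => /=.
Qed.

(* [lin_form c] lies in the span of x_0, .., x_(k-1). *)
Definition vanishes_from (k : nat) (c : 'rV['F_p]_n) : bool :=
  [forall r : 'I_n, (k <= r)%N ==> (c 0 r == 0)].

(** The polynomial h_k. *)
Definition cofactor_poly (k : nat) : {poly P} :=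
  \prod_(c | ~~ vanishes_from k c) ('X - (lin_form c)%:P).

Lemma monic_cofactor_poly k : cofactor_poly k \is monic.
Proof. by apply: monic_prod => c _; exact: monicXsubC. Qed.

(** F is [F0] times h_k, with [F0] monic over S_k. Dividing F by [F0] over S_k leaves a remainder
    that is a multiple of [F0] of smaller size, hence 0, so the quotient is h_k. *)
Lemma coefs_in_cofactor_poly k : coefs_in (adjoin_first k) (cofactor_poly k).
Proof.
set S := adjoin_first k; have sS : subring S by exact: subring_adjoin.
pose F0 : {poly P} := \prod_(c | vanishes_from k c) ('X - (lin_form c)%:P).
have F0_monic : F0 \is monic by apply: monic_prod => c _; exact: monicXsubC.
have SF0 : coefs_in S F0.
  apply: (subring_prod (subring_coefs_in sS)) => c /forallP c0.
  apply: coefs_in_XsubC => //; apply: (subring_sum sS) => r _.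
  have [le_kr|lt_rk] := leqP k r.
    have := c0 r; rewrite le_kr => /eqP->.
    by rewrite scale0r; exact: (subring0 sS).
  rewrite -mul_mpolyC; apply: (subringM sS); first exact: sub_adjoin.
  by apply: adjoin_gen; exists r.
have FE : orbit_poly p n = F0 * cofactor_poly k.
  by rewrite /orbit_poly (bigID (vanishes_from k)).
have SF : coefs_in S (orbit_poly p n) by move=> j; exact: sub_adjoin.
have [q [r [Sq Sr e lt_r]]] := monic_division sS SF0 F0_monic SF.
suff -> : cofactor_poly k = q by [].
have rE : r = (cofactor_poly k - q) * F0.
  by rewrite mulrBl [_ * F0]mulrC -FE e addrAC subrr add0r.
apply/eqP; rewrite -subr_eq0; apply: contraTT lt_r => h_ne.
rewrite rE -leqNgt size_Mmonic //; move: h_ne; rewrite -size_poly_gt0.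
by case: (size _) => // i _; rewrite addSn leq_addl.
Qed.

Lemma fixed_adjoin_first k f : (k <= n)%N ->
  (forall g, fixes_first k g -> lin_subst g f = f) -> adjoin_first k f.
Proof.
move=> le_kn; have [m] : exists m, m = (n - k)%N by exists (n - k)%N.
elim: m k le_kn => [|m IHm] k le_kn mE fixf.
  have -> : k = n by lia.
  exact: adjoin_first_total.
have lt_kn : (k < n)%N by lia.
pose k' : 'I_n := Ordinal lt_kn.
have sS : subring (adjoin_first k) by exact: subring_adjoin.
(* Matrices fixing the first k + 1 variables fix the first k, so by induction [f] lies in S_(k+1),
   hence in S_k[x_k]. *)
have [g0 Sg0 g0f] : [set g.['X_k'] | g in coefs_in (adjoin_first k)] f.
  rewrite -adjoin1E //; apply: (@adjoin_firstS k').
  apply: IHm => [||g [g_unit gX]]; [exact: lt_kn | by rewrite /=; lia | ].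
  apply: fixf; split=> // r lt_rk; apply: gX; exact: ltnW.
have [q [g [_ Sg g0E lt_g]]] := monic_division sS (@coefs_in_cofactor_poly k)
  (monic_cofactor_poly k) Sg0.
pose s := [seq lin_form c | c : 'rV_n <- enum [pred c | ~~ vanishes_from k c]].
have kP : ~~ vanishes_from k (delta_mx 0 k').
  by apply/forallPn; exists k'; rewrite leqnn mxE !eqxx oner_eq0.
have root_h c : ~~ vanishes_from k c -> root (cofactor_poly k) (lin_form c).
  move=> kc; rewrite /cofactor_poly (bigD1 c) //= rootM root_XsubC.
  by rewrite eqxx.
(* x_k is a root of h_k, so the remainder [g] takes the same value there as [g0]. *)
have gX : g.['X_k'] = f.
  rewrite -g0f g0E hornerD hornerM -lin_form_delta.
  by have /rootP-> := root_h _ kP; rewrite mulr0 add0r.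
have size_s : size (cofactor_poly k) = (size s).+1.
  rewrite /cofactor_poly size_map -big_enum /=.
  by rewrite size_prod_XsubC.
(* Some [u] in the stabilizer sends x_k to the given root; it fixes [f] and the coefficients of [g],
   so applying it to g(x_k) = f moves the evaluation point to that root. *)
have root_g c : ~~ vanishes_from k c -> root (g - f%:P) (lin_form c).
  case/forallPn => j; rewrite negb_imply => /andP[le_kj cj0].
  have [u u_unit [uk ur]] := exists_unitmx_row (k := k') le_kj cj0.
  have u_fix : fixes_first k u.
    by split=> // r lt_rk; rewrite lin_substX ur // lin_form_delta.
  have gu : map_poly (lin_subst u) g = g.
    apply/polyP => i; rewrite coef_map /=.
    exact: adjoin_first_fixed (Sg i) u_fix.
  rewrite /root !hornerE subr_eq0 -[X in _ == X](fixf u) // -gX.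
  by rewrite -horner_map /= gu lin_substX uk.
suff gf : g = f%:P by have := Sg 0%N; rewrite gf coefC eqxx.
apply/eqP; rewrite -subr_eq0; apply/negPn/negP => gf0.
have /(max_poly_roots gf0) : all (root (g - f%:P)) s.
  by apply/allP => _ /mapP[c + ->]; rewrite mem_enum; exact: root_g.
(* Ensures that the constant [f], of size at most 1, also fits the bound [size s]. *)
have s_gt0 : (0 < size s)%N.
  by rewrite size_map -cardE; apply/card_gt0P; exists (delta_mx 0 k').
rewrite map_inj_uniq ?enum_uniq; last exact: lin_form_inj.
move=> /(_ isT); rewrite ltnNge (leq_trans (size_polyD _ _)) //.
rewrite geq_max -ltnS -size_s lt_g size_polyN.
by rewrite (leq_trans (size_polyC_leq1 _)).
Qed.

(** The case k = 0: the stabilizer is all of GL_n and S_0 is [A]. *)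
Lemma invariant_generated f :
  (forall g, g \in unitmx -> lin_subst g f = f) -> A f.
Proof.
move=> fixf; suff SA : adjoin_first 0 `<=` A.
  by apply: SA; apply: fixed_adjoin_first => // g [g_unit _]; exact: fixf.
by apply: adjoin_min => // x [r /=].
Qed.

End InvariantsGenerated.

(** * The Dickson polynomial *)

Section DicksonPolynomial.

Variables (p n : nat) (p_prime : prime p).
Local Notation P := {mpoly 'F_p[n]}.
Local Notation K := (fracP p n).
Local Notation toK := (@FracField.tofrac P).
Local Notation x_ r := (toK 'X_r).

Lemma pchar_mpolyFp : p \in [pchar P].
Proof.
by rewrite inE p_prime -mpolyC_nat (pcharf0 (pchar_Fp p_prime)) mpolyC0 eqxx.
Qed.

Lemma pchar_fracP : p \in [pchar K].
Proof.
by rewrite inE p_prime -(rmorph_nat toK) (pcharf0 pchar_mpolyFp) rmorph0 eqxx.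
Qed.

Definition additive_poly m (a : 'I_m -> K) : {poly K} :=
  \sum_(s < m) a s *: 'X^(p ^ s).

Lemma horner_additive_poly m (a : 'I_m -> K) z :
  (additive_poly a).[z] = \sum_(s < m) a s * z ^+ (p ^ s).
Proof. by rewrite horner_sum; apply: eq_bigr => s _; rewrite !hornerE. Qed.

Lemma coef_additive_poly m (a : 'I_m -> K) (s : 'I_m) :
  (additive_poly a)`_(p ^ s) = a s.
Proof.
rewrite coef_sum (bigD1 s) //= coefZ coefXn eqxx mulr1.
rewrite big1 ?addr0 // => t ne_ts.
rewrite coefZ coefXn eqn_exp2l ?prime_gt1 //.
by rewrite eq_sym (inj_eq val_inj) (negbTE ne_ts) mulr0.
Qed.

(** By Frobenius the roots are closed under addition, and scalars of F_p act as repeated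
    addition. *)
Lemma additive_poly_root m (a : 'I_m -> K) :
  (forall r, root (additive_poly a) (x_ r)) ->
  forall c, root (additive_poly a) (toK (lin_form c)).
Proof.
move=> ax0 c.
have rootD y z : root (additive_poly a) y -> root (additive_poly a) z ->
    root (additive_poly a) (y + z).
  rewrite /root !horner_additive_poly => /eqP y0 /eqP z0.
  apply/eqP; transitivity (\sum_(s < m) a s * y ^+ (p ^ s) +
    \sum_(s < m) a s * z ^+ (p ^ s)); last by rewrite y0 z0 addr0.
  rewrite -big_split; apply: eq_bigr => s _ /=.
  rewrite -mulrDr exprDn_pchar // pnatX; apply/orP; left.
  by rewrite pnatE // pchar_fracP.
have root0 : root (additive_poly a) 0.
  rewrite /root horner_additive_poly big1 // => s _.
  by rewrite expr0n expn_eq0 -leqn0 leqNgt prime_gt0 // mulr0.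
rewrite /lin_form rmorph_sum.
apply: (big_ind (fun z => root (additive_poly a) z) root0 rootD) => r _.
rewrite -[c 0 r]natr_Zp scaler_nat rmorphMn.
elim: (nat_of_ord _) => [|k IHk]; first by rewrite mulr0n; exact: root0.
by rewrite mulrS; exact: rootD (ax0 r) IHk.
Qed.

Lemma card_lin_forms : #|{: 'rV['F_p]_n}| = (p ^ n)%N.
Proof. by rewrite card_mx card_Fp // mul1n. Qed.

Lemma uniq_lin_forms : uniq [seq toK (lin_form c) | c : 'rV['F_p]_n].
Proof.
rewrite map_inj_uniq ?enum_uniq // => c c' /eqP.
by rewrite tofrac_eq => /eqP; exact: lin_form_inj.
Qed.

Lemma size_additive_poly_leq m (a : 'I_m -> K) :
  (size (additive_poly a) <= p ^ m)%N.
Proof.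
apply: leq_trans (size_sum _ _ _) _; apply/bigmax_leqP => s _.
rewrite (leq_trans (size_scale_leq _ _)) // size_polyXn.
by rewrite ltn_exp2l ?prime_gt1.
Qed.

(** The additive polynomial with these coefficients has degree below p^n, yet vanishes at all p^n
    elements of V. *)
Lemma frobenius_powers_free (a : 'I_n -> K) :
  (forall r, \sum_(s < n) a s * x_ r ^+ (p ^ s) = 0) -> forall s, a s = 0.
Proof.
move=> ax0 s; rewrite -coef_additive_poly.
suff -> : additive_poly a = 0 by rewrite coef0.
apply/eqP/negPn/negP => /max_poly_roots a_roots.
have := a_roots [seq toK (lin_form c) | c : 'rV['F_p]_n].
rewrite uniq_lin_forms size_map -cardE card_lin_forms.
rewrite ltnNge size_additive_poly_leq.
move=> H; suff /H/(_ isT) : all (root (additive_poly a))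
    [seq toK (lin_form c) | c : 'rV['F_p]_n] by [].
apply/allP => _ /mapP[c _ ->]; apply: additive_poly_root => r.
by rewrite /root horner_additive_poly ax0.
Qed.

(** A vanishing determinant would give a nonzero [v] with sum_s v_s x_r^(p^s) = 0 for every r. *)
Lemma dicksonL_neq0 : dicksonL p n != 0.
Proof.
apply/negP; rewrite /dicksonL /bracket -det_tr => /det0P[v v0 vA].
case/negP: v0; apply/eqP/rowP => s; rewrite mxE.
apply/eqP; rewrite -tofrac_eq0; apply/eqP.
apply: (frobenius_powers_free (a := fun s => toK (v 0 s))) => r.
have := congr1 (fun w : 'rV_n => toK (w 0 r)) vA.
rewrite !mxE rmorph_sum rmorph0 => e.
rewrite -[RHS]e; apply: eq_bigr => t _.
by rewrite !mxE rmorphM rmorphXn.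
Qed.

Let toL_neq0 : toK (dicksonL p n) != 0.
Proof. by rewrite tofrac_eq0 dicksonL_neq0. Qed.

Lemma dicksonLs_top : dicksonLs p n n = dicksonL p n.
Proof.
rewrite /dicksonLs /dicksonL /bracket; congr (\det _); apply/matrixP => r s.
by rewrite !mxE /bump leqNgt ltn_ord.
Qed.

(** Lets the leading term of F be treated like the others, with Q_n = 1. *)
Lemma dicksonQ_top : dicksonQ p n n = 1.
Proof. by rewrite /dicksonQ dicksonLs_top divff. Qed.

(** Expansion along the last row of a square matrix of order n + 1 whose last row repeats row
    [r]. *)
Lemma dicksonLs_relation (r : 'I_n) :
  \sum_(s < n.+1) (-1) ^+ (n + s) * dicksonLs p n s * 'X_r ^+ (p ^ s) = 0 :> P.
Proof.
pose M : 'M[P]_n.+1 := \matrix_(k, s)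
  (if unlift ord_max k is Some k' then 'X_k' else 'X_r) ^+ (p ^ s).
have M0 : \det M = 0.
  apply: (determinant_alternate (neq_lift ord_max r)) => s.
  by rewrite !mxE unlift_none liftK.
rewrite -[RHS]M0 (expand_det_row _ ord_max); apply: eq_bigr => s _.
have -> : M ord_max s = 'X_r ^+ (p ^ s) by rewrite mxE unlift_none.
have -> : cofactor M ord_max s = ((-1) ^+ (n + s) * dicksonLs p n s)%R.
  rewrite /cofactor /dicksonLs /bracket.
  suff -> : row' ord_max (col' s M) =
    \matrix_(k, t) 'X_k ^+ (p ^ bump s t) by [].
  by apply/matrixP => k t; rewrite !mxE liftK.
by rewrite [RHS]mulrC.
Qed.

Definition dickson_poly : {poly K} :=
  additive_poly (fun s : 'I_n.+1 => (-1) ^+ (n + s) * dicksonQ p n s).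

Lemma dickson_poly_root r : root dickson_poly (x_ r).
Proof.
rewrite /root horner_additive_poly; apply/eqP.
transitivity (toK (\sum_(s < n.+1)
    (-1) ^+ (n + s) * dicksonLs p n s * 'X_r ^+ (p ^ s)) / toK (dicksonL p n)).
  rewrite rmorph_sum mulr_suml; apply: eq_bigr => s _ /=.
  rewrite !rmorphM !rmorphXn rmorphN1 /dicksonQ; ring.
by rewrite dicksonLs_relation rmorph0 mul0r.
Qed.

(** The left side is monic of degree p^n and has the p^n distinct elements of V as roots. *)
Lemma dickson_poly_orbit : dickson_poly = map_poly toK (orbit_poly p n).
Proof.
pose F1 := additive_poly (fun s : 'I_n => (-1) ^+ (n + s) * dicksonQ p n s).
have FE : dickson_poly = 'X^(p ^ n) + F1.
  rewrite /dickson_poly /additive_poly big_ord_recr /= addrC dicksonQ_top mulr1.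
  by rewrite addnn -mul2n exprM sqrrN !expr1n scale1r.
have lt_size : (size F1 < size ('X^(p ^ n) : {poly K})%R)%N.
  by rewrite size_polyXn ltnS size_additive_poly_leq.
rewrite (@all_roots_prod_XsubC _ dickson_poly
  [seq toK (lin_form c) | c : 'rV['F_p]_n]).
- rewrite {1}FE lead_coefDl // lead_coefXn scale1r big_map big_enum /=.
  rewrite /orbit_poly rmorph_prod /=; apply: eq_bigr => c _.
  by rewrite rmorphB /= map_polyX map_polyC.
- by rewrite FE size_polyDl // size_polyXn size_map -cardE card_lin_forms.
- apply/allP => _ /mapP[c _ ->]; apply: additive_poly_root.
  exact: dickson_poly_root.
- by rewrite uniq_rootsE uniq_lin_forms.
Qed.

(** Exhibits the quotient of determinants as a polynomial, whose invariance can be read off F. *)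
Lemma dicksonQE s : (s <= n)%N ->
  dicksonQ p n s = toK ((-1) ^+ (n + s) * (orbit_poly p n)`_(p ^ s)).
Proof.
move=> le_sn; pose s' : 'I_n.+1 := Ordinal (le_sn : (s < n.+1)%N).
rewrite rmorphM /= -coef_map -[map_poly _ _]dickson_poly_orbit.
rewrite (coef_additive_poly _ s') /= rmorphXn rmorphN1 mulrA -exprD.
by rewrite addnn -mul2n exprM sqrrN !expr1n mul1r.
Qed.

(** An invertible [g] permutes V, hence the factors of F. *)
Lemma orbit_poly_fixed (g : 'M['F_p]_n) :
  g \in unitmx -> map_poly (lin_subst g) (orbit_poly p n) = orbit_poly p n.
Proof.
move=> g_unit; rewrite /orbit_poly rmorph_prod /=.
rewrite [RHS](reindex (mulmxr g)) /=; last first.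
  by exists (mulmxr (invmx g)) => c _ /=; rewrite ?mulmxK ?mulmxKV.
apply: eq_bigr => c _.
by rewrite rmorphB /= map_polyX map_polyC /= lin_subst_form.
Qed.

Lemma dicksonQ_invariant s : (s <= n)%N -> dicksonD p n (dicksonQ p n s).
Proof.
move=> le_sn; rewrite dicksonQE //.
exists ((-1) ^+ (n + s) * (orbit_poly p n)`_(p ^ s)) => //= g g_unit.
rewrite rmorphM /= rmorphXn rmorphN1 -coef_map.
by have /= -> := orbit_poly_fixed g_unit.
Qed.

(** The matrix of L_(n,0) is the entrywise Frobenius of that of L_n, so L_(n,0) = L_n^p. *)
Lemma dicksonQ0_neq0 : dicksonQ p n 0 != 0.
Proof.
rewrite /dicksonQ; apply: mulf_neq0; last by rewrite invr_eq0.
rewrite tofrac_eq0; suff -> : dicksonLs p n 0 = dicksonL p n ^+ p.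
  by rewrite expf_neq0 ?dicksonL_neq0.
rewrite -(pFrobenius_autE pchar_mpolyFp) -det_map_mx; congr (\det _).
apply/matrixP => r s; rewrite !mxE /= pFrobenius_autE -exprM -expnSr.
by rewrite /bump.
Qed.

Lemma dicksonD_subring : subring (dicksonD p n).
Proof.
split=> [|_ _ [f fi <-] [g gi <-]|_ _ [f fi <-] [g gi <-]].
- by exists 1; [move=> g _; exact: rmorph1 | exact: rmorph1].
- exists (f - g); last exact: rmorphB.
  by move=> h h_unit; rewrite rmorphB /= fi ?gi.
- exists (f * g); last exact: rmorphM.
  by move=> h h_unit; rewrite rmorphM /= fi ?gi.
Qed.

(** [invariant_generated] is applied to the preimage of [A] in the polynomial ring; it contains the
    coefficients of F, each of which is 0, 1 or a signed Q_s. *)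
Lemma dicksonD_generated (A : set K) :
  subring A -> constants p n `<=` A ->
  (forall s, (s < n)%N -> A (dicksonQ p n s)) ->
  A `<=` dicksonD p n -> dicksonD p n = A.
Proof.
move=> sA AC AQ AD; apply/seteqP; split=> // _ [f fi <-].
have sAP : subring [set f : P | A (toK f)].
  split=> [|u v /= Au Av|u v /= Au Av] /=; rewrite ?rmorph1 ?rmorphB ?rmorphM.
  - exact: (subring1 sA).
  - by apply: (subringD sA) => //; exact: (subringN sA).
  - exact: (subringM sA).
apply: (invariant_generated sAP) fi => [a|j|u g Au g_unit] /=.
- by apply: AC; exists a.
- rewrite -coef_map; have /= <- := dickson_poly_orbit; move: j.
  apply: (subring_sum (subring_coefs_in sA)) => s _ j.
  rewrite coefZ coefXn; apply: (subringM sA); last exact: subring_natr.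
  apply: (subringM sA).
    by apply: (subringX sA); apply: (subringN sA); exact: subring1.
  have [lt_sn|le_ns] := ltnP s n; first exact: AQ.
  have -> : s = n :> nat by apply/eqP; rewrite eqn_leq le_ns -ltnS ltn_ord.
  by rewrite dicksonQ_top; exact: subring1.
- have [v vi /eqP] := AD _ Au; rewrite tofrac_eq => /eqP <-; exact: vi.
Qed.

Lemma St_signed i k y : St p i ((-1) ^+ k * y : K) = (-1) ^+ k * St p i y.
Proof.
have [_ dM] := @St_derivation p n i.
rewrite dM (_ : St p i ((-1) ^+ k) = 0) ?mul0r ?add0r //.
have sk := subring_ker_derivation (@St_derivation p n i).
by apply: (subringX sk); apply: (subringN sk); exact: (subring1 sk).
Qed.

Lemma St_dicksonQ (i : nat) s : (i < n)%N -> (s < n)%N ->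
  St p i (dicksonQ p n s) = if s == i then (-1) ^+ i.+1 * dicksonQ p n 0 else 0.
Proof.
move=> lt_in lt_sn; have d_der := @St_derivation p n i; have [dD dM] := d_der.
(* The coefficient of x_r^(p^t) after [St] is applied to F(x_r) = 0, the same for every r. The extra
   term at t = i comes from differentiating x_r in the term of degree 1. *)
pose a (t : 'I_n) : K := (-1) ^+ (n + t) * St p i (dicksonQ p n t) +
  (t == i :> nat)%:R * ((-1) ^+ n * dicksonQ p n 0).
have dX r t : St p i (x_ r ^+ (p ^ t)) = (t == 0%N)%:R * x_ r ^+ (p ^ i).
  rewrite derivationXn // St_toK St_polyX rmorphXn.
  case: t => [|t]; first by rewrite expr0 mulr1n.
  rewrite -[_ *+ _]mulr_natr expnS natrM (pcharf0 pchar_fracP).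
  by rewrite !(mul0r, mulr0).
have a0 t : a t = 0.
  apply: frobenius_powers_free => r.
  pose b (u : nat) := (-1) ^+ (n + u) * (dicksonQ p n u * x_ r ^+ (p ^ u)).
  have b0 : \sum_(u < n.+1) St p i (b u) = 0.
    rewrite -(big_morph _ dD (derivation0 d_der)) -[RHS](derivation0 d_der).
    congr (St p i _); rewrite -[RHS](rootP (dickson_poly_root r)).
    by rewrite horner_additive_poly; apply: eq_bigr => u _; rewrite /b mulrA.
  have bE u : St p i (b u) = (-1) ^+ (n + u) * St p i (dicksonQ p n u) *
      x_ r ^+ (p ^ u) +
      (u == 0%N)%:R * ((-1) ^+ n * dicksonQ p n 0 * x_ r ^+ (p ^ i)).
    rewrite /b St_signed dM dX mulrDr; congr (_ + _); first by rewrite mulrA.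
    case: (u =P 0%N) => [->|_] /=; last by rewrite !(mul0r, mulr0).
    by rewrite addn0 !mul1r mulrA.
  (* The leading term drops out since Q_n = 1 and n > 0, leaving only powers with exponent p^s, s <
     n. *)
  have bn0 : St p i (b n) = 0.
    rewrite bE dicksonQ_top (derivation1 d_der) gtn_eqF ?mul0r ?addr0; last lia.
    by rewrite mulr0 mul0r.
  move: b0; rewrite big_ord_recr /= bn0 addr0 => b0; rewrite -[RHS]b0.
  under [RHS]eq_bigr => u _ do rewrite bE.
  under eq_bigr => u _ do rewrite /a mulrDl.
  rewrite !big_split /=; congr (_ + _).
  (* One summand survives on each side: index i among the [a t], index 0 in the differentiated
     relation. *)
  have n_gt0 : (0 < n)%N by lia.
  rewrite (bigD1 (Ordinal lt_in)) //= eqxx mul1r big1 ?addr0; last first.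
    by move=> u; rewrite -val_eqE => /negbTE /= ->; rewrite !mul0r.
  rewrite (bigD1 (Ordinal n_gt0)) //= mul1r big1 ?addr0 // => u.
  by rewrite -val_eqE => /negbTE /= ->; rewrite !mul0r.
have sqr_sign k : (-1) ^+ k * (-1) ^+ k = 1 :> K.
  by rewrite -exprMn mulrNN mulr1 expr1n.
have := a0 (Ordinal lt_sn); rewrite /a /= => /eqP; rewrite addr_eq0 => /eqP e.
transitivity ((-1) ^+ (n + s) * ((-1) ^+ (n + s) * St p i (dicksonQ p n s))).
  by rewrite mulrA sqr_sign mul1r.
rewrite e.
case: (s =P i) => [->|_] /=; last by rewrite mul0r oppr0 mulr0.
rewrite mul1r exprD mulrN mulrACA sqr_sign mul1r.
by rewrite exprS mulN1r mulNr.
Qed.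

End DicksonPolynomial.

(** * The normalized derivation on the Dickson algebra *)

Section Delta.

Variables (p n i : nat) (p_prime : prime p) (lt_in : (i < n)%N).
Local Notation K := (fracP p n).
Local Notation Q := (dicksonQ p n).
Local Notation C := (dicksonC p n i).

Lemma delta_derivation : derivation (@delta p n i).
Proof.
have [dD dM] := @St_derivation p n i.
by split=> x y; rewrite /delta ?dD ?dM; ring.
Qed.

Lemma delta_dicksonQ : delta p i (Q i) = (-1) ^+ (n + i.+1).
Proof.
rewrite /delta St_dicksonQ // eqxx mulrACA mulVf ?mulr1 -?exprD //.
exact: dicksonQ0_neq0.
Qed.

(** With the sign moved into the argument, where it preserves D_n, the image of [St] becomes Q_0
    times that of [delta]. *)
Lemma St_delta (x : K) : St p i x = Q 0%N * delta p i ((-1) ^+ n * x).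
Proof.
rewrite /delta St_signed [X in Q 0%N * X]mulrACA.
rewrite -exprMn mulrNN mulr1 expr1n mul1r.
by rewrite mulrA divff ?mul1r ?dicksonQ0_neq0.
Qed.

Lemma delta_dicksonC x : C x -> delta p i x = 0.
Proof.
apply: (adjoin_min (subring_ker_derivation delta_derivation)).
  move=> _ [a _ <-]; rewrite /= -[a]natr_Zp mpolyC_nat rmorph_nat.
  exact: (subring_natr (subring_ker_derivation delta_derivation)).
move=> _ [s [lt_sn /eqP/negbTE ne_si] <-].
by rewrite /= /delta St_dicksonQ // ne_si mulr0.
Qed.

(** C[Q_i] consists of invariants and contains F_p and every Q_s with s < n, so [dicksonD_generated]
    applies. *)
Lemma dicksonD_adjoin : dicksonD p n = adjoin C [set Q i].
Proof.
have sD := dicksonD_subring p n.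
have sA := subring_adjoin C [set Q i].
apply: dicksonD_generated => //.
- by move=> a Ka; apply: sub_adjoin; exact: sub_adjoin.
- move=> s lt_sn; have [->|ne_si] := eqVneq s i; first exact: adjoin_gen.
  apply: sub_adjoin; apply: adjoin_gen; exists s => //.
  by split=> //; exact/eqP.
- apply: adjoin_min => //; last by move=> _ ->; apply: dicksonQ_invariant; lia.
  apply: adjoin_min => //.
    move=> _ [a _ <-]; exists a%:MP => //= g _; exact: lin_substC.
  by move=> _ [s [lt_sn _] <-]; apply: dicksonQ_invariant => //; lia.
Qed.

End Delta.

Theorem theorem4p3 (p n i : nat) (p_prime : prime p) (p_odd : odd p)
    (i_gt0 : (0 < i)%N) (i_lt_n : (i < n)%N) :
  let D := dicksonD p n in
  let Q := dicksonQ p n in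
  let C := dicksonC p n i in
  let B := adjoin C [set Q i ^+ p] in
  let N := power_summand B (Q i) in
  let kerD (d : fracP p n -> fracP p n) := [set x | D x /\ d x = 0] in
  let imD (d : fracP p n -> fracP p n) := [set d x | x in D] in
  [/\ D = adjoin C [set Q i] /\ is_direct_sum D (fun r : 'I_p => N r),
      kerD (delta p i) = B /\
        is_direct_sum (imD (delta p i)) (fun r : 'I_p.-1 => N r)
    & kerD (St p i) = B /\
        imD (St p i) =
          [set Q 0%N * x | x in sum_sets (fun r : 'I_p.-1 => N r)]].
Proof.
move=> D Q C B N kerD imD.
have pK := pchar_fracP n p_prime.
have d_der := @delta_derivation p n i.
have sC : subring C by exact: subring_adjoin.
have C1 k : C ((-1) ^+ k).
  by apply: (subringX sC); apply: (subringN sC); exact: (subring1 sC).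
have dC : forall x, C x -> delta p i x = 0 := delta_dicksonC p_prime i_lt_n.
have dQ := delta_dicksonQ p_prime i_lt_n.
(* delta(Q_i) is a sign, hence nonzero, in [C] and of square 1, so Q_i serves as the slice. *)
have dQ0 : delta p i (Q i) != 0 by rewrite dQ signr_eq0.
have CdQ : C (delta p i (Q i)) by rewrite dQ; exact: C1.
have dQ_sqr : delta p i (Q i) * delta p i (Q i) = 1.
  by rewrite dQ -exprMn mulrNN mulr1 expr1n.
have DE : D = adjoin C [set Q i] := dicksonD_adjoin p_prime i_lt_n.
have kerE : kerD (delta p i) = B.
  by rewrite /kerD DE; exact: (slice_ker pK d_der).
have imE : imD (delta p i) = sum_sets (fun r : 'I_p.-1 => N r).
  by rewrite /imD DE; exact: (slice_image pK d_der).
have indep m : (m <= p)%N -> independent (fun r : 'I_m => N r).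
  exact: (power_summand_independent pK d_der).
have D_sign k x : D x -> D ((-1) ^+ k * x).
  move=> Dx; apply: (subringM (dicksonD_subring p n)) => //.
  by rewrite -/D DE; apply: sub_adjoin; exact: C1.
split; split=> //.
- by split; [rewrite DE; exact: (slice_total pK) | exact: indep].
- by split; [exact: imE | apply: indep; exact: leq_pred].
(* [delta] is [St] times a nonzero factor, so their kernels agree. *)
- rewrite -kerE /kerD; apply/seteqP; split=> x [Dx dx0]; split=> //.
    by rewrite /delta dx0 mulr0.
  move: dx0 => /eqP; rewrite /delta !mulf_eq0 signr_eq0 invr_eq0.
  by rewrite (negbTE (dicksonQ0_neq0 n p_prime)) => /eqP.
(* In both directions the preimage x is replaced by (-1)^n x, which stays in D_n. *)
rewrite -imE /imD; apply/seteqP; split=> [_ [x Dx <-]|_ [_ [x Dx <-] <-]].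
  exists (delta p i ((-1) ^+ n * x)); last by rewrite -St_delta.
  by exists ((-1) ^+ n * x) => //; exact: D_sign.
exists ((-1) ^+ n * x); first exact: D_sign.
by rewrite St_delta // mulrA -exprMn mulrNN mulr1 expr1n mul1r.
Qed.
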